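(* Let $\lambda=(\lambda_1,\dots,\lambda_d)$ be a generalized partition of non-positive integers subject to the condition $\lambda_{d-p}\ge -q$. Then $\Delta^*_\lambda$ is a non-zero highest weight vector in $\mathbb{C}[\mathbf{y},\boldsymbol\zeta]$ with respect to the joint actions of $gl_d$ and $gl_{p|q}$. The $gl_d$-weight of $\Delta^*_\lambda$ is $\lambda$, while the $gl_{p|q}$-weight of $\Delta^*_\lambda$ is $-d\mathbf{1}+\widehat\lambda$ with $$\widehat\lambda:=-\big(\langle\mu_p-q\rangle,\langle\mu_{p-1}-q\rangle,\dots,\langle\mu_1-q\rangle,\mu'_q,\mu'_{q-1},\dots,\mu'_1\big),$$ where $\mu=\lambda^*$.
   Context: Ground field $\mathbb{C}$; $d\ge 1$, $p,q\ge 0$ integers. **Generalized partitions.** A generalized partition of length $d$ is a non-increasing sequence $\lambda=(\lambda_1,\dots,\lambda_d)$ of integers; it is a partition of length $d$ if all $\lambda_i\ge 0$. Set $\lambda^*:=(-\lambda_d,\dots,-\lambda_1)$. For a partition $\mu$, $\mu_i:=0$ for $i>d$, and $\mu'$ is the transpose partition ($\mu'_k=0$ for $k>\mu_1$). The condition $\lambda_{d-p}\ge -q$ is regarded as automatically satisfied if $p\ge d$. For an integer $r$, $\langle r\rangle:=\max\{r,0\}$. $\mathbf{1}:=(1,\dots,1,-1,\dots,-1)$ ($p$ entries $1$, then $q$ entries $-1$). **Action.** $\mathbb{C}[\mathbf{y},\boldsymbol\zeta]$ is the polynomial superalgebra generated by even (commuting) variables $y_i^l$ ($1\le i\le p$)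 and odd (anticommuting) variables $\zeta_j^l$ ($1\le j\le q$), $1\le l\le d$. Let $e_{ij}$ ($1\le i,j\le d$) and $E_{ab}$ ($1\le a,b\le p+q$) be the elementary matrices of $gl_d$ and $gl_{p|q}$ (even basis vectors of $\mathbb{C}^{p|q}$ first). They act on $\mathbb{C}[\mathbf{y},\boldsymbol\zeta]$ by the following commuting families of operators ($1\le r,r'\le p$, $1\le s,s'\le q$; products are compositions of operators): $$\bar\phi(e_{ij})=-\sum_{k=1}^p y_k^j\tfrac{\partial}{\partial y_k^i}-\sum_{k=1}^q\zeta_k^j\tfrac{\partial}{\partial\zeta_k^i},$$ $$\bar\phi(E_{rr'})=-\sum_{l=1}^d\tfrac{\partial}{\partial y_r^l}y_{r'}^l,\quad \bar\phi(E_{s+p,s'+p})=\sum_{l=1}^d\tfrac{\partial}{\partial\zeta_s^l}\zeta_{s'}^l,\quad \bar\phi(E_{s+p,r})=-\sum_{l=1}^d\tfrac{\partial}{\partial\zeta_s^l}y_r^l,\quad \bar\phi(E_{r,s+p})=\sum_{l=1}^d\tfrac{\partial}{\partial y_r^l}\zeta_s^l.$$ Highest weight vectors are taken with respect to the standard Borel subalgebras spanned by $e_{ij}$, $i\le j$, and $E_{ab}$, $a\le b$. Weights are written as tuples of eigenvalues of $e_{11},\dots,e_{dd}$, respectively $E_{11},\dots,E_{p+q,p+q}$. **The vectors.** For $1\le r\le\min(d,p)$, $\Delta^*_r$ is the determinant of the $r\times r$ matrix with $(a,b)$-entry $y_{p+1-b}^{d+1-a}$. For $1\le r\le d$ and $1\le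 k\le q$, $\Delta^*_{k,r}:=\zeta_k^d\zeta_k^{d-1}\cdots\zeta_k^{d-r+1}$. With $\mu=\lambda^*$ (a partition with $\mu_{p+1}\le q$), $$\Delta^*_\lambda:=\begin{cases}\prod_{k=1}^{\mu_1}\Delta^*_{q+1-k,\mu'_k}, & \mu_1\le q,\\ \prod_{k=1}^{q}\Delta^*_{q+1-k,\mu'_k}\prod_{l=q+1}^{\mu_1}\Delta^*_{\mu'_l}, & \mu_1>q\end{cases}$$ (empty products are $1$). *)

(* Defs.v *)
From HB Require Import structures.
From mathcomp Require Import all_boot all_order all_algebra.
From mathcomp Require Import reals complex mpoly.

Set Implicit Arguments.
Unset Strict Implicit.
Unset Printing Implicit Defensive.

Import Order.TTheory GRing.Theory Num.Theory.
Local Open Scope ring_scope.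

(* Conventions: all indices are 0-based ordinals, so that i : 'I_n stands for  *)
(* the 1-based index i + 1, and rev_ord i for the 1-based index n - i.         *)

(* -------------------------------------------------------------------------- *)
(* C[y, zeta], realized as C[y] (x) Lambda(zeta).  The even variable y_k^l is   *)
(* numbered mxvec_index k l : 'I_(p * d) and the odd variable zeta_k^l is       *)
(* numbered mxvec_index k l : 'I_(q * d).  An element is the family of its      *)
(* coefficients f S : {mpoly K[p * d]} on the monomials                         *)
(*   zeta_S := zeta_(s_1) * ... * zeta_(s_m),  S = {s_1 < ... < s_m}.           *)
(* This is a transparent alias of a finite function type, but its ring          *)
(* structure is the supercommutative one below, not the pointwise one.          *)
(* -------------------------------------------------------------------------- *)

Definition superpoly (K : comNzRingType) (p q d : nat) :=
  {ffun {set 'I_(q * d)} -> {mpoly K[p * d]}}.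

HB.instance Definition _ (K : comNzRingType) (p q d : nat) :=
  GRing.Lmodule.copy (superpoly K p q d)
    {ffun {set 'I_(q * d)} -> {mpoly K[p * d]}}.

(* zeta_S * zeta_T = (-1) ^ ninv S T * zeta_(S :|: T) for disjoint S and T.    *)
Definition ninv n (S T : {set 'I_n}) : nat :=
  (\sum_(s in S) \sum_(t in T) (t < s)%N)%N.

Lemma ninv0s n (T : {set 'I_n}) : ninv set0 T = 0%N.
Proof. by rewrite /ninv big_set0. Qed.

Lemma ninvs0 n (S : {set 'I_n}) : ninv S set0 = 0%N.
Proof. by rewrite /ninv big1 // => s _; rewrite big_set0. Qed.

Lemma ninvUl n (S1 S2 T : {set 'I_n}) : [disjoint S1 & S2] ->
  ninv (S1 :|: S2) T = (ninv S1 T + ninv S2 T)%N.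
Proof.
by move=> D; rewrite /ninv -bigU //; apply: eq_bigl => s; rewrite in_setU.
Qed.

Lemma ninvUr n (S T1 T2 : {set 'I_n}) : [disjoint T1 & T2] ->
  ninv S (T1 :|: T2) = (ninv S T1 + ninv S T2)%N.
Proof.
move=> D; rewrite /ninv -big_split; apply: eq_bigr => s _.
by rewrite -bigU //; apply: eq_bigl => t; rewrite in_setU.
Qed.

Section SuperpolyRing.
Variables (K : comNzRingType) (p q d : nat).
Implicit Types f g h : superpoly K p q d.

Definition sp_one : superpoly K p q d :=
  [ffun S : {set 'I_(q * d)} => if S == set0 then 1 else 0].

Definition sp_mul f g : superpoly K p q d :=
  [ffun S : {set 'I_(q * d)} => \sum_(T : {set 'I_(q * d)} | T \subset S)
     (-1) ^+ ninv T (S :\: T) * (f T * g (S :\: T))].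

Lemma sp_mulA : associative sp_mul.
Proof.
move=> f g h; apply/ffunP => S; rewrite !ffunE.
under eq_bigr => T _ do rewrite ffunE mulr_sumr mulr_sumr.
under [RHS]eq_bigr => W _ do rewrite ffunE mulr_suml mulr_sumr.
rewrite [RHS](exchange_big_dep (fun T : {set _} => T \subset S)) /=; last first.
  by move=> W T WS TW; apply: subset_trans TW WS.
apply: eq_bigr => T TS.
rewrite [RHS](reindex_onto (fun U => T :|: U) (fun W => W :\: T)) /=; last first.
  by move=> W /andP[_ TW]; rewrite setDE setUIr setUCr setIT; apply/setUidPr.
have cond (U : {set 'I_(q * d)}) : (U \subset S :\: T) =
    (T :|: U \subset S) && (T \subset T :|: U) && ((T :|: U) :\: T == U).
  rewrite subUset TS subsetUl /= andbT subsetD setDUl setDv set0U.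
  congr (_ && _).
  by rewrite eqEsubset subsetDl subsetD subxx.
rewrite (eq_bigl _ _ cond); apply: eq_bigr => U.
rewrite -cond subsetD => /andP[US dUT].
have -> : (T :|: U) :\: T = U.
  by rewrite setDUl setDv set0U; apply/setDidPl.
have -> : (S :\: T) :\: U = S :\: (T :|: U) by rewrite setDDl.
have eST : S :\: T = U :|: (S :\: (T :|: U)).
  rewrite -setDDl -[LHS](setID _ U); congr (_ :|: _).
  by apply/setIidPr; rewrite subsetD US.
have dU : [disjoint U & S :\: (T :|: U)].
  by rewrite disjoints_subset setDE setCI setCK subsetU // orbC subsetUr.
have dTU : [disjoint T & U] by rewrite disjoint_sym.
rewrite eST ninvUr // ninvUl // !exprD.
set a := (-1) ^+ ninv T U; set b := (-1) ^+ ninv T _; set c := (-1) ^+ ninv U _.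
by rewrite -!mulrA [f T * _]mulrCA [c * (a * _)]mulrCA [RHS]mulrCA.
Qed.

Lemma sp_mul1 : left_id sp_one sp_mul.
Proof.
move=> f; apply/ffunP => S; rewrite !ffunE.
rewrite (bigD1 set0) ?sub0set //= big1 ?addr0 => [|T /andP[_ /negPf T0]].
  by rewrite ffunE eqxx ninv0s setD0 !mul1r.
by rewrite ffunE T0 mul0r mulr0.
Qed.

Lemma sp_mulr1 : right_id sp_one sp_mul.
Proof.
move=> f; apply/ffunP => S; rewrite !ffunE.
rewrite (bigD1 S) //= big1 ?addr0 => [|T /andP[TS neTS]].
  by rewrite ffunE setDv eqxx ninvs0 mulr1 mul1r.
rewrite ffunE setD_eq0 ifF ?mulr0 //; apply: contra_neqF neTS => ST.
by apply/eqP; rewrite eqEsubset TS.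
Qed.

Lemma sp_mulDl : left_distributive sp_mul +%R.
Proof.
move=> f g h; apply/ffunP => S; rewrite !ffunE -big_split /=.
by apply: eq_bigr => T _; rewrite ffunE mulrDl mulrDr.
Qed.

Lemma sp_mulDr : right_distributive sp_mul +%R.
Proof.
move=> f g h; apply/ffunP => S; rewrite !ffunE -big_split /=.
by apply: eq_bigr => T _; rewrite ffunE !mulrDr.
Qed.

Lemma sp_1neq0 : sp_one != 0.
Proof.
apply/eqP => /ffunP /(_ set0); rewrite !ffunE eqxx => /eqP.
by rewrite oner_eq0.
Qed.

HB.instance Definition _ := GRing.Zmodule_isNzRing.Build (superpoly K p q d)
  sp_mulA sp_mul1 sp_mulr1 sp_mulDl sp_mulDr sp_1neq0.

Lemma sp_scalerAl (a : K) f g : a *: (f * g) = (a *: f) * g.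
Proof.
apply/ffunP => S; rewrite !ffunE scaler_sumr; apply: eq_bigr => T _.
by rewrite ffunE -scalerAl -scalerAr.
Qed.

Lemma sp_scalerAr (a : K) f g : a *: (f * g) = f * (a *: g).
Proof.
apply/ffunP => S; rewrite !ffunE scaler_sumr; apply: eq_bigr => T _.
by rewrite ffunE -!scalerAr.
Qed.

HB.instance Definition _ :=
  GRing.Lmodule_isLalgebra.Build K (superpoly K p q d) sp_scalerAl.
HB.instance Definition _ :=
  GRing.Lalgebra_isAlgebra.Build K (superpoly K p q d) sp_scalerAr.

Definition yvar (k : 'I_p) (l : 'I_d) : superpoly K p q d :=
  [ffun S : {set 'I_(q * d)} => if S == set0 then 'X_(mxvec_index k l) else 0].

Definition zvar (k : 'I_q) (l : 'I_d) : superpoly K p q d :=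
  [ffun S : {set 'I_(q * d)} => if S == [set mxvec_index k l] then 1 else 0].

Definition dy (k : 'I_p) (l : 'I_d) f : superpoly K p q d :=
  [ffun S : {set 'I_(q * d)} => mderiv (mxvec_index k l) (f S)].

(* left odd derivative: d_i (zeta_i * zeta_S) = zeta_S for i \notin S          *)
Definition dz (k : 'I_q) (l : 'I_d) f : superpoly K p q d :=
  [ffun S : {set 'I_(q * d)} => let i := mxvec_index k l in
     if i \in S then 0 else (-1) ^+ ninv [set i] S * f (i |: S)].

Definition gl_act (i j : 'I_d) f : superpoly K p q d :=
  - (\sum_(k < p) yvar k j * dy k i f) - \sum_(k < q) zvar k j * dz k i f.

Definition glpq_act (a b : 'I_(p + q)) f : superpoly K p q d :=
  match split a, split b with
  | inl r, inl r' => - \sum_(l < d) dy r l (yvar r' l * f)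
  | inr s, inr s' => \sum_(l < d) dz s l (zvar s' l * f)
  | inr s, inl r  => - \sum_(l < d) dz s l (yvar r l * f)
  | inl r, inr s  => \sum_(l < d) dy r l (zvar s l * f)
  end.

End SuperpolyRing.

(* v is a highest weight vector of weight wt for the standard Borel subalgebra, *)
(* where act i j is the operator by which the matrix unit e_ij acts.            *)
Definition is_hwv (K : comNzRingType) (V : lmodType K) n
    (act : 'I_n -> 'I_n -> V -> V) (wt : 'I_n -> int) (v : V) : Prop :=
  [/\ v != 0,
      forall i j : 'I_n, (i < j)%N -> act i j v = 0
    & forall i : 'I_n, act i i v = (wt i)%:~R *: v].

Definition is_gpartition d (lam : 'I_d -> int) : Prop :=
  forall i j : 'I_d, (i <= j)%N -> lam j <= lam i.

Definition gpdual d (lam : 'I_d -> int) : 'I_d -> int :=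
  fun i => - lam (rev_ord i).

(* Only meant for a partition mu (all entries nonnegative), where absz is the   *)
(* conversion to nat: part mu i = mu_(i+1), which is 0 for i >= d, and          *)
(* tpart mu k = mu'_(k+1) = #{i | mu_i >= k + 1}.                               *)
Definition part d (mu : 'I_d -> int) (i : nat) : nat :=
  if insub i is Some j then `|mu j|%N else 0%N.

Definition tpart d (mu : 'I_d -> int) (k : nat) : nat :=
  #|[set i : 'I_d | (k < part mu i)%N]|.

Section HighestWeightVector.
Variables (K : comNzRingType) (p q d : nat).

(* Row and column indices of the determinant are below r <= min(d, p) wherever  *)
(* Delta_even is meant; the default 0 is only reached for larger r.             *)
Definition Delta_even (r : nat) : superpoly K p q d :=
  \det (\matrix_(a < r, b < r)
    if (insub (a : nat) : option 'I_d, insub (b : nat) : option 'I_p)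
       is (Some l, Some k)
    then yvar K q (rev_ord k) (rev_ord l) else 0).

(* The factors zeta_k^d, zeta_k^(d-1), ... come in this order.                  *)
Definition Delta_odd (k : 'I_q) (r : nat) : superpoly K p q d :=
  \prod_(l < d | (l < r)%N) zvar K p k (rev_ord l).

Definition Delta_star (lam : 'I_d -> int) : superpoly K p q d :=
  let mu := gpdual lam in
  if (part mu 0 <= q)%N then
    \prod_(k < q | (k < part mu 0)%N) Delta_odd (rev_ord k) (tpart mu k)
  else
    (\prod_(k < q) Delta_odd (rev_ord k) (tpart mu k)) *
    \prod_(q <= l < part mu 0) Delta_even (tpart mu l).

End HighestWeightVector.

Definition pospart (r : int) : int := Num.max r 0.

Definition one_pq p q (a : 'I_(p + q)) : int :=
  match split a with inl _ => 1 | inr _ => -1 end.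

Definition lamhat p q d (lam : 'I_d -> int) (a : 'I_(p + q)) : int :=
  let mu := gpdual lam in
  match split a with
  | inl r => - pospart ((part mu (rev_ord r))%:Z - q%:Z)
  | inr s => - (tpart mu (rev_ord s))%:Z
  end.

(* Main.v *)
(* Up to a sign, Delta_star lam is g * zeta_S, where S is the set of all
   (k, l) with rev l < mu'_(rev k) and g is a product of minors of the matrix of
   even variables.  The even parts of the operators act on g by derivations
   ("polarizations") replacing one row or column index of the variables by
   another; such a derivation annihilates a minor or reproduces it, because a
   determinant with two equal rows vanishes.  The odd parts only move elements
   of S, and the raising operators move them to places that are already
   occupied, since mu' is decreasing. *)
Require Import Defs.
From HB Require Import structures.
From mathcomp Require Import all_boot all_order all_algebra.
From mathcomp Require Import reals complex mpoly zify.

Import Order.TTheory GRing.Theory Num.Theory.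
Local Open Scope ring_scope.

(** * Derivations of a commutative ring *)

Section Derivation.
Variables (A : comNzRingType) (D : A -> A).
Hypothesis derD : {morph D : x y / x + y}.
Hypothesis derM : forall x y, D (x * y) = D x * y + x * D y.

Lemma derivation0 : D 0 = 0.
Proof. by apply: (addrI (D 0)); rewrite -derD !addr0. Qed.

Lemma derivation1 : D 1 = 0.
Proof.
by apply: (addrI (D 1)); rewrite addr0 -{3}[1]mulr1 derM mulr1 mul1r.
Qed.

Lemma derivationN x : D (- x) = - D x.
Proof. by apply: (addrI (D x)); rewrite -derD !subrr derivation0. Qed.

Lemma derivation_sign n x : D ((-1) ^+ n * x) = (-1) ^+ n * D x.
Proof. by rewrite -signr_odd !mulr_sign; case: ifP => // _;
  rewrite derivationN. Qed.

Lemma derivation_sum I (r : seq I) (P : pred I) F :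
  D (\sum_(i <- r | P i) F i) = \sum_(i <- r | P i) D (F i).
Proof. exact: (big_morph D derD derivation0). Qed.

(** The differentiated factor is singled out by an index test, which agrees with the Leibniz rule
    only if no index repeats; hence [uniq]. *)
Lemma derivation_prod (I : eqType) (r : seq I) (F : I -> A) : uniq r ->
  D (\prod_(j <- r) F j) =
  \sum_(i <- r) \prod_(j <- r) (if j == i then D (F j) else F j).
Proof.
elim: r => [_|a r IHr /= /andP[ar ur]]; first by rewrite !big_nil derivation1.
rewrite big_cons derM IHr // big_cons big_cons eqxx; congr (_ * _ + _).
  by apply: eq_big_seq => j jr; rewrite (negPf (memPn ar _ jr)).
rewrite mulr_sumr; apply: eq_big_seq => i ir.
by rewrite big_cons eq_sym (negPf (memPn ar _ ir)).
Qed.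
End Derivation.

(** * Derivations of products and determinants *)

Section DerivationDet.
Variables (A : comNzRingType) (D : A -> A).
Hypothesis derD : {morph D : x y / x + y}.
Hypothesis derM : forall x y, D (x * y) = D x * y + x * D y.

(** By Leibniz, eigenvalues add under products. With all [c i] zero, a product of constants of [D]
    is again a constant. *)
Lemma derivation_prod_eigen I (r : seq I) (P : pred I) (F : I -> A)
    (c : I -> nat) :
  (forall i, P i -> D (F i) = F i *+ c i) ->
  D (\prod_(i <- r | P i) F i) =
  (\prod_(i <- r | P i) F i) *+ (\sum_(i <- r | P i) c i).
Proof.
move=> DF; elim: r => [|a r IHr]; first by rewrite !big_nil derivation1.
rewrite !big_cons; case: ifPn => // Pa.
by rewrite derM IHr DF // mulrnDr mulrnAl mulrnAr.
Qed.

(** Leibniz on each term of the permutation expansion picks one row; exchanging the two sums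
    collects, for each row, the determinant with that row differentiated. *)
Lemma derivation_det n (B : 'M[A]_n) :
  D (\det B) = \sum_i \det (\matrix_(a, b) if a == i then D (B a b) else B a b).
Proof.
rewrite derivation_sum // exchange_big; apply: eq_bigr => s _ /=.
rewrite derivation_sign // -mulr_sumr derivation_prod ?index_enum_uniq //.
congr (_ * _); apply: eq_bigr => i _; apply: eq_bigr => a _.
by rewrite mxE.
Qed.

Lemma derivation_det0 n (B : 'M[A]_n) :
  (forall a b, D (B a b) = 0) -> D (\det B) = 0.
Proof.
move=> DB; rewrite derivation_det big1 // => i _; rewrite (expand_det_row _ i).
by rewrite big1 // => j _; rewrite mxE eqxx DB mul0r.
Qed.

(** [D] turns row [i] into row [j] and kills the others. If [j < i < n], the minor also contains row
    [j], so two rows become equal; if [n <= i], every entry is killed. Indexing by all of [nat] lets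
    one array serve every size [n]. *)
Lemma derivation_det_row (B : nat -> nat -> A) (i j n : nat) : (j <= i)%N ->
  (forall a b, D (B a b) = if a == i then B j b else 0) ->
  let M := \det (\matrix_(a < n, b < n) B a b) in
  D M = M *+ ((j == i) && (i < n)%N).
Proof.
move=> leji DB /=; have [lt_in|le_ni] := ltnP i n; last first.
  rewrite andbF mulr0n derivation_det0 // => a b; rewrite mxE DB ifN //.
  by rewrite neq_ltn (leq_trans _ le_ni).
rewrite andbT derivation_det (bigD1 (Ordinal lt_in)) //= [X in _ + X]big1 =>
  [|k ki].
  rewrite addr0; have [eq_ji|ne_ji] := eqVneq j i.
    rewrite mulr1n; congr (\det _); apply/matrixP => a b; rewrite !mxE DB eq_ji.
    by rewrite -val_eqE /=; case: eqP => // ->.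
  have lt_jn := leq_ltn_trans leji lt_in.
  rewrite (determinant_alternate (i1 := Ordinal lt_in) (i2 := Ordinal lt_jn)) //.
    by rewrite -val_eqE eq_sym.
  by move=> b; rewrite !mxE DB -!val_eqE /= eqxx (negPf ne_ji).
rewrite (expand_det_row _ k) big1 // => b _.
by rewrite !mxE eqxx DB ifN ?mul0r.
Qed.

Lemma derivation_det_col (B : nat -> nat -> A) (i j n : nat) : (j <= i)%N ->
  (forall a b, D (B a b) = if b == i then B a j else 0) ->
  let M := \det (\matrix_(a < n, b < n) B a b) in
  D M = M *+ ((j == i) && (i < n)%N).
Proof.
move=> leji DB /=; rewrite -det_tr.
have -> : (\matrix_(a < n, b < n) B a b)^T = \matrix_(a < n, b < n) B b a.
  by apply/matrixP => a b; rewrite !mxE.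
by apply: (derivation_det_row (fun a b => B b a)).
Qed.
End DerivationDet.

(** * Calculus of terms with a single odd monomial *)

Section Zmono.
Variables (K : comNzRingType) (p q d : nat).
Implicit Types (S T : {set 'I_(q * d)}) (f g : {mpoly K[p * d]}).

(* f * zeta_S *)
Definition zmono S f : superpoly K p q d :=
  [ffun U : {set 'I_(q * d)} => if U == S then f else 0].

Lemma zmono_is_zmod_morphism S : zmod_morphism (zmono S).
Proof. by move=> f g; apply/ffunP => U; rewrite !ffunE; case: eqP;
  rewrite ?subr0. Qed.

HB.instance Definition _ S :=
  GRing.isZmodMorphism.Build _ _ (zmono S) (zmono_is_zmod_morphism S).

Lemma zmono_eq0 S f : (zmono S f == 0) = (f == 0).
Proof.
apply/eqP/eqP => [/ffunP/(_ S)|->]; first by rewrite !ffunE eqxx.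
by rewrite raddf0.
Qed.

Lemma mulr_zmono S T f g : [disjoint S & T] ->
  zmono S f * zmono T g = zmono (S :|: T) ((-1) ^+ ninv S T * (f * g)).
Proof.
move=> dST; apply/ffunP => U; rewrite !ffunE.
have [->|neU] := eqVneq U (S :|: T).
  rewrite (bigD1 S) ?subsetUl //= !ffunE eqxx setDUl setDv set0U.
  move: (dST); rewrite disjoint_sym => /setDidPl ->.
  rewrite eqxx big1 ?addr0 // => W /andP[_ /negPf neW].
  by rewrite ffunE neW mul0r mulr0.
rewrite big1 // => W sWU; rewrite !ffunE.
case: eqP => [eW|_]; last by rewrite mul0r mulr0.
case: eqP => [eT|_]; last by rewrite !mulr0.
by case/eqP: neU; rewrite -eW -eT setDE setUIr setUCr setIT;
  apply/esym/setUidPr.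
Qed.

Lemma mulr_zmono0 S T f g : ~~ [disjoint S & T] -> zmono S f * zmono T g = 0.
Proof.
move=> dST; apply/ffunP => U; rewrite !ffunE big1 // => W sWU; rewrite !ffunE.
case: eqP => [eW|_]; last by rewrite mul0r mulr0.
case: eqP => [eT|_]; last by rewrite !mulr0.
case/negP: dST; rewrite -eW -eT disjoint_sym disjoints_subset setDE.
exact: subsetIr.
Qed.

Lemma zmono0M T f g : zmono set0 f * zmono T g = zmono T (f * g).
Proof.
by rewrite mulr_zmono ?disjoints_subset ?sub0set // ninv0s set0U mul1r.
Qed.

Lemma zmonoM0 T f g : zmono T f * zmono set0 g = zmono T (f * g).
Proof.
rewrite mulr_zmono; last by rewrite disjoint_sym disjoints_subset sub0set.
by rewrite ninvs0 setU0 mul1r.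
Qed.

Lemma zmono0_is_monoid_morphism : monoid_morphism (zmono set0).
Proof. by split=> // f g; rewrite zmono0M. Qed.

HB.instance Definition _ :=
  GRing.isMonoidMorphism.Build _ _ (zmono set0) zmono0_is_monoid_morphism.

(** The reordering sign is left existential: non-vanishing and weight equations do not depend on it.
    Each factor may carry its own sign, so that the lemma also applies to products of products. *)
Lemma prod_zmono (I : eqType) (r : seq I) (P : pred I)
    (F : I -> superpoly K p q d) (S : I -> {set 'I_(q * d)}) : uniq r ->
  (forall i j, i != j -> [disjoint S i & S j]) ->
  (forall i, P i -> exists e, F i = zmono (S i) ((-1) ^+ e)) ->
  exists e,
    \prod_(i <- r | P i) F i = zmono (\bigcup_(i <- r | P i) S i) ((-1) ^+ e).
Proof.
move=> + dS FS; elim: r => [_|a r IHr /= /andP[ar ur]].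
  by exists 0%N; rewrite !big_nil.
have [e IHe] := IHr ur; rewrite !big_cons IHe; case: ifPn => [Pa|_];
  last by exists e.
have [e' ->] := FS a Pa; rewrite mulr_zmono.
  by rewrite -!exprD; eexists.
(* [uniq] keeps [a] out of the tail, so [S a] is disjoint from every later support and hence from
   their union. *)
rewrite big_seq_cond; elim/big_ind: _ => [|U V|j /andP[jr _]].
- by rewrite disjoint_sym disjoints_subset sub0set.
- by rewrite !(disjoint_sym (S a)) !disjoints_subset subUset => -> ->.
- by apply: dS; rewrite eq_sym (memPn ar).
Qed.

Lemma yvarE k l : yvar K q k l = zmono set0 'X_(mxvec_index k l).
Proof. by []. Qed.

Lemma zvarE k l : zvar K p k l = zmono [set mxvec_index k l] 1.
Proof. by []. Qed.

Lemma dy_zmono k l S f :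
  dy k l (zmono S f) = zmono S (mderiv (mxvec_index k l) f).
Proof. by apply/ffunP => U; rewrite !ffunE; case: eqP; rewrite ?mderiv0. Qed.

Lemma zvarM_zmono0 k l S f : mxvec_index k l \in S ->
  zvar K p k l * zmono S f = 0.
Proof. by move=> kS; rewrite zvarE mulr_zmono0 // disjoints1 kS. Qed.

Lemma zvarM_zmono k l S f : let i := mxvec_index k l in i \notin S ->
  zvar K p k l * zmono S f = zmono (i |: S) ((-1) ^+ ninv [set i] S * f).
Proof. by move=> i kS; rewrite zvarE mulr_zmono ?disjoints1 // mul1r. Qed.

Lemma dz_zmono0 k l S f : mxvec_index k l \notin S -> dz k l (zmono S f) = 0.
Proof.
move=> kS; apply/ffunP => U; rewrite !ffunE /= ffunE
  [if _ == _ then _ else _]ifN ?mulr0 ?if_same //.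
by apply: contraNneq kS => <-; rewrite setU11.
Qed.

Lemma dz0 k l : dz k l (0 : superpoly K p q d) = 0.
Proof. by apply/ffunP => U; rewrite !ffunE /= ffunE mulr0 if_same. Qed.

Lemma dz_zmono k l S f : let i := mxvec_index k l in i \in S ->
  dz k l (zmono S f) = zmono (S :\ i) ((-1) ^+ ninv [set i] (S :\ i) * f).
Proof.
move=> i iS; apply/ffunP => U; rewrite !ffunE /= -/i ffunE.
have [->|neU] := eqVneq U (S :\ i);
  first by rewrite !inE eqxx /= setD1K // eqxx.
have [//|iU] := boolP (i \in U); rewrite ifN ?mulr0 //;
  apply: contra neU => /eqP <-.
by rewrite setU1K.
Qed.

(** Removing a variable and putting it back costs the same sign twice, so the composite detects an
    occupied place. *)
Lemma zvar_dz_diag k l S f :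
  zvar K p k l * dz k l (zmono S f) = zmono S f *+ (mxvec_index k l \in S).
Proof.
set i := mxvec_index k l; have [iS|iS] := boolP (i \in S); last first.
  by rewrite dz_zmono0 // mulr0.
rewrite dz_zmono // zvarM_zmono -/i ?setD11 // setD1K //.
by rewrite mulrA -exprD addnn -mul2n exprM sqrrN !expr1n mul1r.
Qed.

(** In this order the two equal signs cancel as well, but a vacant place is detected. *)
Lemma dz_zvar_diag k l S f :
  dz k l (zvar K p k l * zmono S f) = zmono S f *+ (mxvec_index k l \notin S).
Proof.
set i := mxvec_index k l; have [iS|iS] := boolP (i \in S).
  by rewrite zvarM_zmono0 // dz0.
rewrite zvarM_zmono // dz_zmono -/i ?setU11 // setU1K //.
by rewrite mulrA -exprD addnn -mul2n exprM sqrrN !expr1n mul1r.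
Qed.
End Zmono.
Arguments zmono {K p q d}.

(** * Polarization operators *)

Lemma mxvec_index_inj m n (i i' : 'I_m) (j j' : 'I_n) :
  mxvec_index i j = mxvec_index i' j' -> i = i' /\ j = j'.
Proof.
have [g gK _] := curry_mxvec_bij m n.
move=> eq_ij; have := gK (i, j) isT.
by rewrite /= eq_ij (gK (i', j') isT) => -[-> ->].
Qed.

Lemma mderivXU (A : nzRingType) n (i j : 'I_n) :
  mderiv i 'X_j = (i == j)%:R :> {mpoly A[n]}.
Proof.
rewrite mderivX mnm1E eq_sym; case: eqP => [->|_]; last by rewrite scale0r.
rewrite scale1r -mpolyX0; congr mpolyX.
by apply/mnmP => k; rewrite mnmBE mnm0E subnn.
Qed.

Section Polarization.
Variables (K : comNzRingType) (n : nat) (I : finType) (u v : I -> 'I_n).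
Implicit Types f g : {mpoly K[n]}.

(** For injective [u], this is the derivation sending ['X_(u k)] to ['X_(v k)] and every other
    variable to 0; the even parts of both actions are built from it. *)
Definition polar f : {mpoly K[n]} := \sum_k 'X_(v k) * mderiv (u k) f.

Lemma polarD : {morph polar : f g / f + g}.
Proof.
by move=> f g; rewrite /polar -big_split; apply: eq_bigr => k _;
  rewrite mderivD mulrDr.
Qed.

Lemma polarM f g : polar (f * g) = polar f * g + f * polar g.
Proof.
rewrite /polar mulr_suml mulr_sumr -big_split; apply: eq_bigr => k _ /=.
by rewrite mderivM mulrDr; congr (_ + _); [exact: mulrA | exact: mulrCA].
Qed.

Lemma polarX k : injective u -> polar 'X_(u k) = 'X_(v k).
Proof.
move=> u_inj; rewrite /polar (bigD1 k) //= mderivXU eqxx mulr1 big1 ?addr0 //.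
by move=> j jk; rewrite mderivXU (inj_eq u_inj) (negPf jk) mulr0.
Qed.

Lemma polarX0 i : (forall k, u k != i) -> polar 'X_i = 0.
Proof. by move=> ui; rewrite /polar big1 // => k _;
  rewrite mderivXU (negPf (ui k)) mulr0. Qed.
End Polarization.

(** * Minors of the matrix of even variables *)

Section EvenMinor.
Variables (K : comNzRingType) (p q d : nat).

(** The default 0 extends the matrices of all the minors to one infinite array, as the lemmas on
    derivations of determinants require. Rows carry the superscripts and columns the subscripts,
    both reversed. *)
Definition yentry (a b : nat) : {mpoly K[p * d]} :=
  if (insub a : option 'I_d, insub b : option 'I_p) is (Some l, Some k)
  then 'X_(mxvec_index (rev_ord k) (rev_ord l)) else 0.

Definition yminor (r : nat) : {mpoly K[p * d]} :=
  \det (\matrix_(a < r, b < r) yentry a b).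

(** [zmono set0] is a ring morphism, hence commutes with determinants; the minors can thus be
    studied among commutative polynomials. *)
Lemma Delta_evenE r : Delta_even K p q d r = zmono set0 (yminor r).
Proof.
rewrite -det_map_mx; congr (\det _); apply/matrixP => a b; rewrite !mxE /yentry.
by case: insub => [l|]; rewrite ?raddf0 //; case: insub => [k|];
  rewrite ?raddf0.
Qed.

Definition gl_polar (i j : 'I_d) : {mpoly K[p * d]} -> {mpoly K[p * d]} :=
  polar _ _ _ (fun k : 'I_p => mxvec_index k i) (fun k => mxvec_index k j).

Definition glp_polar (r r' : 'I_p) : {mpoly K[p * d]} -> {mpoly K[p * d]} :=
  polar _ _ _ (fun l : 'I_d => mxvec_index r l) (fun l => mxvec_index r' l).

(** The polarization replaces row [rev_ord i] by row [rev_ord j]; since reversal flips [i <= j], the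
    replacing row comes no later than the replaced one. *)
Lemma gl_polar_yminor (i j : 'I_d) t : (i <= j)%N ->
  gl_polar i j (yminor t) = yminor t *+ ((i == j) && (rev_ord i < t)%N).
Proof.
move=> leij.
have -> : (i == j) = (rev_ord j == rev_ord i :> nat).
  by rewrite (inj_eq val_inj) (inj_eq rev_ord_inj) eq_sym.
apply: (derivation_det_row _ (gl_polar i j) _ _ yentry) => [||/=|a b].
- exact: polarD.
- exact: polarM.
- lia.
rewrite /yentry; case: (insubP 'I_d a) => [l _ <-|ad]; last first.
  rewrite ifN ?derivation0 //; first exact: polarD.
  by apply: contraNneq ad => ->.
rewrite (inj_eq val_inj) valK.
case: insub => [k|]; last by rewrite if_same derivation0 //; exact: polarD.
rewrite -(inj_eq rev_ord_inj) rev_ordK; case: eqP => [->|ne].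
  by rewrite rev_ordK /gl_polar polarX // => k1 k2 /mxvec_index_inj[].
rewrite /gl_polar polarX0 // => k'; apply/eqP => /mxvec_index_inj[_ /esym].
exact: ne.
Qed.

(** The same argument on columns, which carry the subscripts. *)
Lemma glp_polar_yminor (r r' : 'I_p) t : (r <= r')%N ->
  glp_polar r r' (yminor t) = yminor t *+ ((r == r') && (rev_ord r < t)%N).
Proof.
move=> lerr'.
have -> : (r == r') = (rev_ord r' == rev_ord r :> nat).
  by rewrite (inj_eq val_inj) (inj_eq rev_ord_inj) eq_sym.
apply: (derivation_det_col _ (glp_polar r r') _ _ yentry) => [||/=|a b].
- exact: polarD.
- exact: polarM.
- lia.
rewrite /yentry; case: insub => [l|]; last by rewrite if_same derivation0 //;
  exact: polarD.
case: (insubP 'I_p b) => [k _ <-|bp]; last first.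
  rewrite ifN ?derivation0 //; first exact: polarD.
  by apply: contraNneq bp => ->.
rewrite (inj_eq val_inj) valK.
rewrite -(inj_eq rev_ord_inj) rev_ordK; case: eqP => [->|ne].
  by rewrite rev_ordK /glp_polar polarX // => l1 l2 /mxvec_index_inj[].
rewrite /glp_polar polarX0 // => l'; apply/eqP => /mxvec_index_inj[/esym].
by move=> /ne.
Qed.

(** A minor of size [t] only involves superscripts whose reversal is below [t]. *)
Lemma mderiv_yminor0 (k : 'I_p) (l : 'I_d) t : (t <= rev_ord l)%N ->
  mderiv (mxvec_index k l) (yminor t) = 0.
Proof.
move=> tl; apply: derivation_det0 => [||a b]; [exact: mderivD|exact: mderivM|].
rewrite mxE /yentry; case: (insubP 'I_d a) => [l' _ la|_];
  last by rewrite mderiv0.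
case: insub => [k'|]; last by rewrite mderiv0.
rewrite mderivXU; case: eqP => // /mxvec_index_inj[_ ll'].
by move: tl; rewrite ll' rev_ordK la leqNgt ltn_ord.
Qed.

(** At the point [v] the array [yentry] becomes the identity matrix, so the minor takes the value 1.
    The bound on [t] keeps the default entries out. *)
Lemma yminor_neq0 t : (t <= minn d p)%N -> yminor t != 0.
Proof.
rewrite leq_min => /andP[td tp].
pose v m : K :=
  mxvec (\matrix_(k < p, l < d) (rev_ord k == rev_ord l :> nat)%:R) 0 m.
apply/eqP => /(congr1 (meval v)); rewrite -det_map_mx meval0.
have -> : map_mx (meval v) (\matrix_(a < t, b < t) yentry a b) = 1%:M.
  apply/matrixP => a b; rewrite !mxE /yentry.
  rewrite (insubT (fun x => x < d)%N (leq_trans (ltn_ord a) td)).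
  rewrite (insubT (fun x => x < p)%N (leq_trans (ltn_ord b) tp)).
  by rewrite mevalXU /v mxvecE mxE !rev_ordK /= eq_sym.
by rewrite det1 => /eqP; rewrite oner_eq0.
Qed.
End EvenMinor.

(** * Counting, and partitions with their transposes *)

(** Truncated subtraction covers [m <= q] too; it later becomes the positive part in the weight. *)
Lemma sum_ltn_nat q n m : (\sum_(q <= l < n) (l < m) = minn m n - q)%N.
Proof.
elim: n => [|n IHn]; first by rewrite big_geq //; lia.
have [leqn|ltnq] := leqP q n; last by rewrite big_geq //; lia.
by rewrite big_nat_recr //= IHn; case: ltnP; lia.
Qed.

Lemma sum_ltn_ord n m : (\sum_(i < n) (i < m) = minn m n)%N.
Proof. by rewrite -(big_mkord xpredT (fun i => nat_of_bool (i < m)%N))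
  sum_ltn_nat subn0. Qed.

Lemma sum_rev_ltn_ord n m : (\sum_(i < n) (rev_ord i < m) = minn m n)%N.
Proof.
by rewrite (reindex_inj rev_ord_inj) -sum_ltn_ord; apply: eq_bigr => i _;
  rewrite rev_ordK.
Qed.

Section Partition.
Variables (d : nat) (mu : 'I_d -> int).
Hypothesis mu_gpart : is_gpartition mu.
Hypothesis mu_ge0 : forall i, 0 <= mu i.

Lemma part_ord (i : 'I_d) : part mu i = `|mu i|%N.
Proof. by rewrite /part valK. Qed.

Lemma part_ge a : (d <= a)%N -> part mu a = 0%N.
Proof. by rewrite /part; case: insubP => // i; rewrite ltnNge => /negPf->. Qed.

Lemma part_anti a b : (a <= b)%N -> (part mu b <= part mu a)%N.
Proof.
move=> leab; have [ltbd|/part_ge->//] := ltnP b d.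
have ltad := leq_ltn_trans leab ltbd.
rewrite (part_ord (Ordinal ltad)) (part_ord (Ordinal ltbd)).
have := mu_gpart (Ordinal ltad) (Ordinal ltbd) leab.
by have := mu_ge0 (Ordinal ltad); have := mu_ge0 (Ordinal ltbd); lia.
Qed.

(** As [mu] decreases, the indices counted by [tpart mu l] form an initial segment, so [a] belongs
    to it exactly when [a] is below its cardinality. This duality turns counts over column heights
    into row lengths. *)
Lemma ltn_tpart a l : (a < tpart mu l)%N = (l < part mu a)%N.
Proof.
have card_lt b : #|[set i : 'I_d | (i < b)%N]| = minn b d.
  by rewrite -sum_ltn_ord -sum1_card big_mkcond; apply: eq_bigr => i _;
    rewrite inE; case: ltnP.
rewrite /tpart; have [ltla|lela] := ltnP l (part mu a).
  have ltad : (a < d)%N by rewrite ltnNge; apply: contraTN ltla => /part_ge->.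
  rewrite -(minn_idPl ltad) -card_lt; apply: subset_leq_card.
  apply/subsetP => i; rewrite !inE ltnS => /part_anti; exact: leq_trans ltla.
apply/negbTE; rewrite -leqNgt.
apply: leq_trans (geq_minl a d); rewrite -card_lt; apply: subset_leq_card.
apply/subsetP => i; rewrite !inE => ltli; rewrite ltnNge.
apply: contraL ltli => /part_anti leia; rewrite -leqNgt.
exact: leq_trans leia lela.
Qed.

Lemma tpart_anti k l : (k <= l)%N -> (tpart mu l <= tpart mu k)%N.
Proof.
move=> lekl; rewrite leqNgt ltn_tpart -leqNgt.
(* Otherwise row [tpart mu k] would be longer than [l], hence than [k], which by duality reads
   [tpart mu k < tpart mu k]. *)
case: ltnP => // ltk; have : (l < part mu (tpart mu k))%N by [].
by move/(leq_ltn_trans lekl); rewrite -ltn_tpart ltnn.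
Qed.

Lemma tpart_le l : (tpart mu l <= d)%N.
Proof. by rewrite leqNgt ltn_tpart part_ge. Qed.
End Partition.

(** * The odd monomial of the vector *)

Section OddSupport.
Variables (q d : nat).

Definition zrow (k : 'I_q) (r : nat) : {set 'I_(q * d)} :=
  \bigcup_(l < d | (l < r)%N) [set mxvec_index k (rev_ord l)].

Definition zsupp (t : nat -> nat) : {set 'I_(q * d)} :=
  \bigcup_(k < q) zrow (rev_ord k) (t k).

Lemma mem_zrow k l k' r :
  (mxvec_index k l \in zrow k' r) = (k == k') && (rev_ord l < r)%N.
Proof.
apply/bigcupP/andP => [[l' lt_l'r /set1P/mxvec_index_inj[-> ->]]|[/eqP->
  lt_lr]].
  by rewrite rev_ordK.
by exists (rev_ord l); rewrite ?rev_ordK ?set11.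
Qed.

Lemma mem_zsupp k l t :
  (mxvec_index k l \in zsupp t) = (rev_ord l < t (rev_ord k))%N.
Proof.
apply/bigcupP/idP => [[k' _]|lt_lt].
  by rewrite mem_zrow => /andP[/eqP->]; rewrite rev_ordK.
by exists (rev_ord k); rewrite // mem_zrow rev_ordK eqxx.
Qed.

Lemma disjoint_zrow k k' r r' : k != k' -> [disjoint zrow k r & zrow k' r'].
Proof.
move=> kk'; rewrite -setI_eq0; apply/eqP/setP => i.
case/mxvec_indexP: i => k1 l1; rewrite !inE !mem_zrow.
by case: eqP => [->|//]; rewrite (negPf kk') andbF.
Qed.

Lemma prod_Delta_odd (K : comNzRingType) p (t : nat -> nat) : exists e,
  \prod_(k < q) Delta_odd K p d (rev_ord k) (t k) = zmono (zsupp t) ((-1) ^+ e).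
Proof.
apply: prod_zmono => [|k k' kk'|k _]; first exact: index_enum_uniq.
  by apply: disjoint_zrow; rewrite (inj_eq rev_ord_inj).
apply: prod_zmono => [|l l' ll'|l _]; first exact: index_enum_uniq.
  rewrite disjoints1 inE; apply: contra ll' => /eqP/mxvec_index_inj[_].
  by move/rev_ord_inj->.
by exists 0%N.
Qed.
End OddSupport.

(** * The two actions on a single term *)

Section HighestWeight.
Variables (K : comNzRingType) (p q d : nat).
Implicit Types (S : {set 'I_(q * d)}) (g : {mpoly K[p * d]}).

(** For [i != j] the odd part would move a variable of [S] to a place that the hypothesis on [S]
    makes occupied. The factor [i == j] treats raising operators and weights together; the number of
    occupied places with superscript [i] adds to the eigenvalue [c] of [g]. *)
Lemma gl_act_zmono (i j : 'I_d) S g (c : nat) :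
  (forall k, mxvec_index k i \in S -> mxvec_index k j \in S) ->
  gl_polar K p d i j g = g *+ ((i == j) * c) ->
  gl_act i j (zmono S g) =
  - (zmono S g *+ ((i == j) * (c + \sum_(k < q) (mxvec_index k i \in S)))).
Proof.
move=> Sij gij; rewrite /gl_act mulnDr mulrnDr opprD; congr (- _ - _).
  rewrite -raddfMn /= -gij /gl_polar /polar raddf_sum /=.
  by apply: eq_bigr => k _; rewrite dy_zmono yvarE zmono0M.
rewrite big_distrr /= -sumrMnr; apply: eq_bigr => k _.
have [<-|ne_ij] := eqVneq i j; first by rewrite zvar_dz_diag mul1n.
rewrite mul0n mulr0n; have [iS|iS] := boolP (mxvec_index k i \in S).
  rewrite dz_zmono // zvarM_zmono0 // !inE Sij // andbT.
  by apply: contra ne_ij => /eqP/mxvec_index_inj[_ ->].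
by rewrite dz_zmono0 // mulr0.
Qed.

(** The derivative acts after the multiplication; commuting the two yields one extra [g] per
    superscript when [r = r'], whence the shift by [d]. *)
Lemma glpq_act_even (r r' : 'I_p) S g (c : nat) :
  glp_polar K p d r r' g = g *+ ((r == r') * c) ->
  glpq_act (lshift q r) (lshift q r') (zmono S g) =
  - (zmono S g *+ ((r == r') * (d + c))).
Proof.
move=> grr; rewrite /glpq_act !(unsplitK (inl _)); congr (- _).
rewrite -raddfMn /= mulnDr mulrnDr -grr /glp_polar /polar raddfD raddf_sum /=.
under eq_bigr => l _.
  rewrite yvarE zmono0M dy_zmono mderivM mderivXU raddfD /=.
  over.
rewrite big_split; congr (_ + _) => /=.
have [->|ne_rr'] := eqVneq r r'.
  under eq_bigr => l _ do rewrite eqxx mul1r.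
  by rewrite sumr_const card_ord mul1n raddfMn.
rewrite mul0n mulr0n raddf0 big1 // => l _.
case: eqP => [/mxvec_index_inj[eq_rr' _]|_]; last by rewrite mul0r raddf0.
by rewrite eq_rr' eqxx in ne_rr'.
Qed.

(** For [s != s'], if the place of [s'] is vacant, so is that of [s], and the derivative finds
    nothing to remove. For [s = s'] the derivative acts last, so vacant places are counted. *)
Lemma glpq_act_odd (s s' : 'I_q) S g :
  (forall l, mxvec_index s l \in S -> mxvec_index s' l \in S) ->
  glpq_act (rshift p s) (rshift p s') (zmono S g) =
  zmono S g *+ ((s == s') * \sum_(l < d) (mxvec_index s l \notin S)).
Proof.
move=> Sss'; rewrite /glpq_act !(unsplitK (inr _)).
rewrite big_distrr /= -sumrMnr; apply: eq_bigr => l _.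
have [<-|ne_ss'] := eqVneq s s'; first by rewrite dz_zvar_diag mul1n.
rewrite mul0n mulr0n; have [s'S|s'S] := boolP (mxvec_index s' l \in S).
  by rewrite zvarM_zmono0 // dz0.
rewrite zvarM_zmono // dz_zmono0 // !inE negb_or.
rewrite (contra (Sss' l)) // andbT.
by apply: contra ne_ss' => /eqP/mxvec_index_inj[->].
Qed.

(** Each summand dies for one of two reasons: its odd variable already divides the monomial, or the
    derivative of [g] vanishes. *)
Lemma glpq_act_even_odd (r : 'I_p) (s : 'I_q) S g :
  (forall l, mxvec_index s l \notin S -> mderiv (mxvec_index r l) g = 0) ->
  glpq_act (lshift q r) (rshift p s) (zmono S g) = 0.
Proof.
move=> Sg; rewrite /glpq_act (unsplitK (inl _)) (unsplitK (inr _)) big1 //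
  => l _.
have [sS|sS] := boolP (mxvec_index s l \in S).
  by rewrite zvarM_zmono0 //; apply/ffunP => U; rewrite !ffunE mderiv0.
by rewrite zvarM_zmono // dy_zmono derivation_sign ?Sg ?mulr0 ?raddf0 //;
  exact: mderivD.
Qed.
End HighestWeight.

(** * Weights of the vector *)

Section DeltaStar.
Variables (K : idomainType) (p q d : nat) (lam : 'I_d -> int).
Hypothesis lam_gpart : is_gpartition lam.
Hypothesis lam_npos : forall i, lam i <= 0.
Hypothesis lam_cond : forall i : 'I_d, (i.+1 + p = d)%N -> - q%:Z <= lam i.

Let mu := gpdual lam.
Let N := part mu 0.
Let S : {set 'I_(q * d)} := zsupp q d (tpart mu).

Lemma gpdual_gpart : is_gpartition mu.
Proof. by move=> i j leij; rewrite /mu /gpdual lerN2 lam_gpart //=; lia. Qed.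

Lemma gpdual_ge0 i : 0 <= mu i.
Proof. by rewrite oppr_ge0. Qed.

Let ltn_tp := ltn_tpart _ _ gpdual_gpart gpdual_ge0.
Let part_le a b := part_anti _ _ gpdual_gpart gpdual_ge0 a b.

(** For [p < d], the reversal of index [p] is the [i] with [i.+1 + p = d], where [lam_cond] applies;
    otherwise the part is 0 by default. *)
Lemma part_hook_le : (part mu p <= q)%N.
Proof.
have [ltpd|/part_ge->//] := ltnP p d; rewrite (part_ord _ _ (Ordinal ltpd)).
have := @lam_cond (rev_ord (Ordinal ltpd)).
by have := gpdual_ge0 (Ordinal ltpd);
  rewrite /mu /gpdual /= subnSK // subnK ?(ltnW ltpd) //; lia.
Qed.

(** Both cases of the definition merge: if [N <= q], the even product is empty, and the odd factors
    with [N <= k] have height 0, hence equal 1. *)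
Lemma Delta_starE : exists e,
  Delta_star K p q lam =
    zmono S ((-1) ^+ e * \prod_(q <= l < N) yminor K p d (tpart mu l)).
Proof.
have [e prodE] := prod_Delta_odd q d K p (tpart mu); exists e.
rewrite -zmonoM0 -prodE rmorph_prod /=.
under [X in _ * X]eq_bigr => l _ do rewrite -Delta_evenE.
rewrite /Delta_star -/mu -/N; case: leqP => [leNq|//].
rewrite [X in _ * X]big_geq // mulr1 big_mkcond; apply: eq_bigr => k _.
case: ltnP => // leNk; have -> : tpart mu k = 0%N.
  by apply/eqP; rewrite -leqn0 leqNgt ltn_tp -leqNgt.
by rewrite /Delta_odd big_pred0.
Qed.

Lemma Delta_star_neq0 : Delta_star K p q lam != 0.
Proof.
have [e ->] := Delta_starE; rewrite zmono_eq0 mulf_neq0 ?signr_eq0 //.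
rewrite big_seq prodf_seq_neq0; apply/allP => l;
  rewrite mem_index_iota => /andP[leql _].
apply/implyP => _; apply: yminor_neq0;
  rewrite leq_min (tpart_le _ _ gpdual_gpart gpdual_ge0) /=.
(* A size above [p] would mean [l < part mu p <= q], against [q <= l]. *)
by rewrite leqNgt ltn_tp -leqNgt (leq_trans part_hook_le).
Qed.

Lemma Delta_star_gl : is_hwv (@gl_act K p q d) lam (Delta_star K p q lam).
Proof.
have gl_weight (i j : 'I_d) : (i <= j)%N -> gl_act i j (Delta_star K p q lam) =
    - (Delta_star K p q lam *+ ((i == j) * part mu (rev_ord i))).
  move=> leij; have [e ->] := Delta_starE.
  rewrite (gl_act_zmono _ _ _ _ _ _ _ _
    (\sum_(q <= l < N) (rev_ord i < tpart mu l))%N).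
  - congr (- (_ *+ (_ * _))).
    under eq_bigr => l _ do rewrite ltn_tp.
    under [X in (_ + X)%N]eq_bigr => k _ do rewrite mem_zsupp ltn_tp.
    (* With [m = part mu (rev_ord i)], the minors contribute the truncated [m - q] and the odd
       variables [minn m q], in total [m]. *)
    rewrite sum_ltn_nat sum_rev_ltn_ord;
      have : (part mu (rev_ord i) <= N)%N by exact: part_le.
    lia.
  - move=> k; rewrite !mem_zsupp; apply: leq_trans; rewrite ltnS /=; lia.
  - rewrite /gl_polar derivation_sign; last exact: polarD.
    rewrite -mulrnAr; congr (_ * _); rewrite big_distrr.
    apply: derivation_prod_eigen => [|l _]; first exact: polarM.
    by rewrite /= mulnb; exact: gl_polar_yminor.
split=> [|i j ltij|i]; first exact: Delta_star_neq0.
  by rewrite gl_weight ?(ltnW ltij) // -val_eqE /= ltn_eqF // mulr0n oppr0.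
rewrite gl_weight // eqxx mul1n part_ord /mu /gpdual rev_ordK.
(* Being nonpositive, [lam i] is 0 or a [Negz]; the eigenvalue is minus its absolute value. *)
have := lam_npos i; case: (lam i) => n //.
  by case: n => // _; rewrite scale0r mulr0n oppr0.
by rewrite NegzE => _; rewrite opprK absz_nat mulrNz scaleNr scaler_nat.
Qed.

Lemma Delta_star_glpq : is_hwv (@glpq_act K p q d)
  (fun a => - d%:Z * one_pq a + lamhat lam a) (Delta_star K p q lam).
Proof.
have even_weight (r r' : 'I_p) : (r <= r')%N ->
    glpq_act (lshift q r) (lshift q r') (Delta_star K p q lam) =
    - (Delta_star K p q lam *+ ((r == r') * (d + (part mu (rev_ord r) - q)))).
  move=> lerr'; have [e ->] := Delta_starE.
  rewrite (glpq_act_even _ _ _ _ _ _ _ _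
    (\sum_(q <= l < N) (rev_ord r < tpart mu l))%N).
    congr (- (_ *+ (_ * (_ + _)))).
    under eq_bigr => l _ do rewrite ltn_tp.
    by rewrite sum_ltn_nat (minn_idPl _) // part_le.
  rewrite /glp_polar derivation_sign; last exact: polarD.
  rewrite -mulrnAr; congr (_ * _); rewrite big_distrr.
  apply: derivation_prod_eigen => [|l _]; first exact: polarM.
  by rewrite /= mulnb; exact: glp_polar_yminor.
have odd_weight (s s' : 'I_q) : (s <= s')%N ->
    glpq_act (rshift p s) (rshift p s') (Delta_star K p q lam) =
    Delta_star K p q lam *+ ((s == s') * (d - tpart mu (rev_ord s))).
  move=> less'; have [e ->] := Delta_starE.
  rewrite glpq_act_odd.
    congr (_ *+ (_ * _)).
    under eq_bigr => l _ do rewrite mem_zsupp.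
    set t := tpart mu _.
    have sum_t : (\sum_(l < d) (rev_ord l < t) = t)%N.
      by rewrite sum_rev_ltn_ord (minn_idPl (tpart_le _ _ gpdual_gpart
        gpdual_ge0 _)).
    (* Vacant places are counted as the complement of the occupied ones among [d]. *)
    have : (\sum_(l < d) (~~ (rev_ord l < t) + (rev_ord l < t)) = d)%N.
      by under eq_bigr => l _ do rewrite addn_negb; rewrite sum1_card card_ord.
    by rewrite big_split /= sum_t => /(canRL (addnK t)).
  move=> l; rewrite !mem_zsupp => /leq_trans; apply.
  by apply: tpart_anti; [exact: gpdual_gpart|exact: gpdual_ge0|rewrite /=; lia].
have even_odd (r : 'I_p) (s : 'I_q) :
    glpq_act (lshift q r) (rshift p s) (Delta_star K p q lam) = 0.
  have [e ->] := Delta_starE; apply: glpq_act_even_odd => l.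
  (* The place is vacant when its column height is at most [rev_ord l]. The minors have sizes
     [tpart mu m] with [rev_ord s < q <= m], which are no larger, so none involves superscript
     [l]. *)
  rewrite mem_zsupp -leqNgt => lel.
  rewrite derivation_sign; last exact: mderivD.
  rewrite big_seq (derivation_prod_eigen _ _ (mderivM _) _ _ _ _ (fun=> 0%N)).
    by rewrite [X in _ *+ X]big1 // mulr0n mulr0.
  move=> m; rewrite mem_index_iota => /andP[leqm _]; rewrite mulr0n.
  apply: mderiv_yminor0; apply: leq_trans lel.
  apply: tpart_anti; [exact: gpdual_gpart|exact: gpdual_ge0|].
  by apply: leq_trans leqm; exact/ltnW/ltn_ord.
split=> [|a b|a]; first exact: Delta_star_neq0.
  (* Of the mixed cases, an even [a] with an odd [b] is closed by [even_odd], and the opposite one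
     contradicts [a < b]. *)
  case: (split_ordP a) => [r|s] ->; case: (split_ordP b) => [r'|s'] -> //= ltab.
  - by rewrite even_weight ?(ltnW ltab) // -val_eqE /= ltn_eqF // mulr0n oppr0.
  - by have := ltn_ord r'; lia.
  - have lts : (s < s')%N by lia.
    by rewrite odd_weight ?(ltnW lts) // -val_eqE /= ltn_eqF // mulr0n.
rewrite scaler_int /one_pq /lamhat -/mu.
case: (split_ordP a) => [r|s] ->.
  rewrite even_weight // eqxx mul1n.
  rewrite pmulrn -mulrNz; congr (_ *~ _); rewrite /pospart; lia.
rewrite odd_weight // eqxx mul1n pmulrn; congr (_ *~ _).
(* The bound by [d] makes the truncated [d - tpart] a true difference of integers. *)
have := tpart_le _ _ gpdual_gpart gpdual_ge0 (rev_ord s); lia.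
Qed.
End DeltaStar.

Theorem lemma2p2 (R : realType) (p q d : nat) (d_ge1 : (1 <= d)%N)
    (lam : 'I_d -> int)
    (lam_gpart : is_gpartition lam)
    (lam_npos : forall i : 'I_d, lam i <= 0)
    (lam_cond : forall i : 'I_d, (i.+1 + p = d)%N -> - q%:Z <= lam i) :
  let Delta : superpoly R[i] p q d := Delta_star R[i] p q lam in
  is_hwv (@gl_act R[i] p q d) lam Delta /\
  is_hwv (@glpq_act R[i] p q d)
    (fun a => - d%:Z * one_pq a + lamhat lam a) Delta.
Proof. by split; [exact: Delta_star_gl | exact: Delta_star_glpq]. Qed.
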